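(* Let $\mathcal{S}$ be a finite set of solvers and $\mathcal{P}$ a finite set of test problems, with $|\mathcal{S}|\ge 2$ and $|\mathcal{P}|\ge 1$. Suppose $f^{(p)}(x_0^{(p)})\ge f_L^{(p)}$ for every $p\in\mathcal{P}$. Then for every $s\in\mathcal{S}$ the function $Q_s:[0,1]\to[0,1]$ is nondecreasing.
   Context: For each test problem $p\in\mathcal{P}$, $f^{(p)}$ is its real-valued objective function (to be minimized) and $x_0^{(p)}$ is the starting point common to all solvers. For $s\in\mathcal{S}$, $f_s^{(p)}(x^\ast)\in\mathbb{R}$ denotes the value of $f^{(p)}$ at the best point $x^\ast$ found by solver $s$ on problem $p$ (the dependence of $x^\ast$ on $s$ and $p$ is suppressed). The reference value is $f_L^{(p)}=\min_{s\in\mathcal{S}} f_s^{(p)}(x^\ast)$. For $\tau\ge 0$, $$Q_s(\tau)=\frac{1}{|\mathcal{P}|}\,\Bigl|\bigl\{p\in\mathcal{P} : f_s^{(p)}(x^\ast)-f_L^{(p)}\le \tau\,[\,f^{(p)}(x_0^{(p)})-f_L^{(p)}\,]\bigr\}\Bigr|.$$ *)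

(* Defs.v *)
From HB Require Import structures.
From mathcomp Require Import all_boot all_order all_algebra.
From mathcomp Require Import reals.

Set Implicit Arguments.
Unset Strict Implicit.
Unset Printing Implicit Defensive.

Import Order.TTheory GRing.Theory Num.Theory.
Local Open Scope ring_scope.

Section DataProfile.
Context {R : realType} {S P : finType}.

(* Problem p has its own domain X p; xbest s p is the best point found by
   solver s on problem p. *)
Variables (X : P -> Type) (f : forall p, X p -> R) (x0 : forall p, X p).
Variable xbest : S -> forall p, X p.

Definition solver_value (s : S) (p : P) : R := f (xbest s p).

(* The value 0 is taken only when S is empty; see ref_valueP. *)
Definition ref_value (p : P) : R :=
  if [pick s : S] is Some s0
  then \big[Num.min/solver_value s0 p]_(s : S) solver_value s p
  else 0.

Definition solved (s : S) (tau : R) : {set P} :=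
  [set p | solver_value s p - ref_value p <= tau * (f (x0 p) - ref_value p)].

Definition Q (s : S) (tau : R) : R := #|solved s tau|%:R / #|P|%:R.

Lemma ref_valueP (p : P) : (0 < #|S|)%N ->
  (exists s, ref_value p = solver_value s p) /\
  (forall s, ref_value p <= solver_value s p).
Proof.
move=> /card_gt0P[s1 _]; rewrite /ref_value; case: pickP => [s0 _|/(_ s1)//].
split; last by move=> s; exact: bigmin_le_cond.
elim/big_ind: _ => [|x y [s ->] [t ->]|s _]; [by exists s0| |by exists s].
by rewrite /Num.min; case: ifP => _; [exists s|exists t].
Qed.

End DataProfile.

(* Main.v *)
Require Import Defs.
From HB Require Import structures.
From mathcomp Require Import all_boot all_order all_algebra.
From mathcomp Require Import reals.

Set Implicit Arguments.
Unset Strict Implicit.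
Unset Printing Implicit Defensive.

Import Order.TTheory GRing.Theory Num.Theory.
Local Open Scope ring_scope.

(** A problem counts for [Q] as soon as its gap to the reference value is at
    most [tau] times the gap at the starting point.  The latter gap is
    nonnegative by hypothesis, so raising [tau] only loosens each test: the
    sets of solved problems are nested, and [Q] is their cardinality divided
    by a constant.  The bounds 0 and 1 hold because these sets lie in [P]. *)

Lemma solved_subset (R : realType) (S P : finType)
    (X : P -> Type) (f : forall p : P, X p -> R) (x0 : forall p : P, X p)
    (xbest : S -> forall p : P, X p) (s : S) (tau1 tau2 : R) :
  (forall p : P, ref_value f xbest p <= f p (x0 p)) -> tau1 <= tau2 ->
  solved f x0 xbest s tau1 \subset solved f x0 xbest s tau2.
Proof.
move=> hx0 le_tau; apply/subsetP => p; rewrite !inE => /le_trans; apply.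
by rewrite ler_wpM2r // subr_ge0.
Qed.

Theorem lemma2p3 (R : realType) (S P : finType)
    (X : P -> Type) (f : forall p : P, X p -> R) (x0 : forall p : P, X p)
    (xbest : S -> forall p : P, X p)
    (hS : (2 <= #|S|)%N) (hP : (1 <= #|P|)%N)
    (hx0 : forall p : P, ref_value f xbest p <= f p (x0 p)) :
  forall s : S,
    (forall tau : R, 0 <= tau <= 1 -> 0 <= Q f x0 xbest s tau <= 1) /\
    (forall tau1 tau2 : R, 0 <= tau1 <= 1 -> 0 <= tau2 <= 1 ->
       tau1 <= tau2 -> Q f x0 xbest s tau1 <= Q f x0 xbest s tau2).
Proof.
have P_gt0 : 0 < #|P|%:R :> R by rewrite ltr0n.
move=> s; split=> [tau _|tau1 tau2 _ _ le_tau]; rewrite /Q.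
  by rewrite divr_ge0 ?ler0n //= ler_pdivrMr // mul1r ler_nat max_card.
rewrite ler_wpM2r ?invr_ge0 ?ler0n // ler_nat.
exact/subset_leq_card/solved_subset.
Qed.
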